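(* Let $n\ge 1$ and let $\Delta=(\Delta_{ij})$ be an integer $n\times n$ matrix such that $\det\Delta\neq 0$, $\Delta_{ij}\le 0$ for all $i\ne j$, and there exists a vector $\mathbf r\in\mathbb Z^n$ with $\mathbf r>0$ and $\mathbf r\Delta\ge 0$. Then for any $\mathbf r,\mathbf r'\in\mathscr R(\Delta)$, $\mathcal P(\Delta,\mathbf r)=\mathcal P(\Delta,\mathbf r')$.
   Context: Vectors are row vectors. $\mathbf r>0$ means $r_i>0$ for all $i$; $\mathbf r\ge \mathbf r'$ means $r_i\ge r'_i$ for all $i$. $\mathscr R(\Delta)=\{\mathbf r\in\mathbb Z^n : \mathbf r>0,\ \mathbf r\Delta\ge 0\}$. For $\mathbf r\in\mathscr R(\Delta)$, $\Omega(\mathbf r)$ is the set of integer vectors $\chi=(\chi(1),\dots,\chi(n))$ with $0\le\chi(i)\le r_i$ for every $i$ and $\chi(i)\ne 0$ for some $i$. $\Delta^j$ is the $j$-th column of $\Delta$, and $\langle X,Y\rangle=\sum_{i=1}^n X_iY_i$. A $(\Delta,\mathbf r)$-parking function is a function $f:\{1,\dots,n\}\to\{0,1,2,\dots\}$ such that for every $\chi\in\Omega(\mathbf r)$ there exists $j$ with $\chi(j)\ge 1$ and $0\le f(j)<\langle\chi,\Delta^j\rangle$. $\mathcal P(\Delta,\mathbf r)$ is the set of $(\Delta,\mathbf r)$-parking functions. *)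

(* Defs.v *)
From mathcomp Require Import all_boot all_order all_algebra.
From mathcomp Require Import classical_sets.

Set Implicit Arguments.
Unset Strict Implicit.
Unset Printing Implicit Defensive.

Import Order.TTheory GRing.Theory Num.Theory.
Local Open Scope ring_scope.
Local Open Scope classical_set_scope.

(* Indices 1, ..., n are represented by 'I_n, i.e. 0, ..., n - 1. *)

Definition pos_vec (n : nat) (r : 'rV[int]_n) : Prop :=
  forall i : 'I_n, 0 < r 0 i.

(* Coordinatewise order: r >= s. *)
Definition ge_vec (n : nat) (r s : 'rV[int]_n) : Prop :=
  forall i : 'I_n, s 0 i <= r 0 i.

Definition Rset (n : nat) (Delta : 'M[int]_n) : set 'rV[int]_n :=
  [set r | pos_vec r /\ ge_vec (r *m Delta) 0].

Definition Omega (n : nat) (r : 'rV[int]_n) : set 'rV[int]_n :=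
  [set chi | (forall i : 'I_n, 0 <= chi 0 i <= r 0 i) /\
             (exists i : 'I_n, chi 0 i != 0)].

Definition pairing (n : nat) (X : 'rV[int]_n) (Y : 'cV[int]_n) : int :=
  \sum_(i < n) X 0 i * Y i 0.

Definition is_parking (n : nat) (Delta : 'M[int]_n) (r : 'rV[int]_n)
    (f : 'I_n -> nat) : Prop :=
  forall chi : 'rV[int]_n, Omega r chi ->
    exists j : 'I_n,
      1 <= chi 0 j /\ 0 <= (f j)%:Z < pairing chi (col j Delta).

Definition parking_functions (n : nat) (Delta : 'M[int]_n) (r : 'rV[int]_n) :
    set ('I_n -> nat) :=
  [set f | is_parking Delta r f].

(* Main.v *)
Require Import Defs.
From mathcomp Require Import all_boot all_order all_algebra.
From mathcomp Require Import classical_sets.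
From mathcomp Require Import zify.

Import Order.TTheory GRing.Theory Num.Theory.
Local Open Scope ring_scope.

(* The defining condition of a (Delta, r)-parking function extends from
   Omega(r) to all nonzero chi >= 0, and this extended condition does not
   involve r.  If chi <= r fails, the positive part chi' of chi - r is nonzero,
   and <chi', Delta^j> <= <chi - r, Delta^j> <= <chi, Delta^j> for all j with
   chi'(j) >= 1; hence a witness j for chi' is a witness for chi.  Iterating,
   one ends below r. *)

Definition pos_part_sub {n : nat} (chi r : 'rV[int]_n) : 'rV[int]_n :=
  \row_i Num.max 0 (chi 0 i - r 0 i).

Lemma pairing_mulmx {n : nat} (Delta : 'M[int]_n) (chi : 'rV[int]_n) j :
  pairing chi (col j Delta) = (chi *m Delta) 0 j.
Proof. by rewrite /pairing mxE; apply: eq_bigr => i _; rewrite mxE. Qed.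

(** Taking the positive part of [chi - r] only raises negative coordinates to 0. Coordinate [j] is
    already at least 1 and stays put, so the raised ones meet off-diagonal entries of column [j],
    which are nonpositive. Adding [r] back contributes entry [j] of [r *m Delta], which is
    nonnegative. *)
Lemma pairing_pos_part_sub {n : nat} (Delta : 'M[int]_n)
    (offdiag_le0 : forall i j : 'I_n, i <> j -> Delta i j <= 0)
    (r chi : 'rV[int]_n) (j : 'I_n) :
  ge_vec (r *m Delta) 0 -> 1 <= pos_part_sub chi r 0 j ->
  pairing (pos_part_sub chi r) (col j Delta) <= pairing chi (col j Delta).
Proof.
move=> /(_ j); rewrite mxE => rD_ge0 chi'j.
rewrite !pairing_mulmx; apply: (@le_trans _ _ (((chi - r) *m Delta) 0 j)).
  rewrite !mxE; apply: ler_sum => i _; rewrite !mxE.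
  have [->|/eqP/offdiag_le0] := eqVneq i j; last first.
    by move=> Dij; apply: ler_wnM2r => //; rewrite le_max lexx orbT.
  by rewrite max_r //; move: chi'j; rewrite mxE; lia.
by rewrite mulmxBl [leLHS]mxE [X in _ + X]mxE gerBl.
Qed.

Lemma is_parking_all {n : nat} (Delta : 'M[int]_n)
    (offdiag_le0 : forall i j : 'I_n, i <> j -> Delta i j <= 0)
    (r : 'rV[int]_n) (f : 'I_n -> nat) (chi : 'rV[int]_n) :
  Rset Delta r -> is_parking Delta r f ->
  (forall i, 0 <= chi 0 i) -> (exists i, chi 0 i != 0) ->
  exists j, 1 <= chi 0 j /\ 0 <= (f j)%:Z < pairing chi (col j Delta).
Proof.
move=> [r_gt0 rD_ge0] parkf.
(* [N] bounds the number of subtractions of [r]; with [N.+1], the base case [N = 0] says that [chi]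
   lies below [r]. The largest absolute value of an entry suffices, since each [r 0 i] is at least
   1. *)
have [N] : exists N, forall i, chi 0 i <= r 0 i * N.+1%:Z.
  exists (\max_i `|chi 0%R i|)%N => i.
  have := leq_bigmax (F := fun i => `|chi 0%R i|%N) i.
  by have := r_gt0 i; nia.
elim: N chi => [|N IHN] chi chi_le chi_ge0 chi_neq0.
  by apply: parkf; split=> // i; rewrite chi_ge0 -[leRHS]mulr1 chi_le.
have [/forallP chi_le_r|/forallPn[k]] := boolP [forall i, chi 0 i <= r 0 i].
  by apply: parkf; split=> // i; rewrite chi_ge0 chi_le_r.
rewrite -ltNge => r_lt_chi.
have [|i||j [chi'j /andP[f_ge0 f_lt]]] := IHN (pos_part_sub chi r).
- by move=> i; rewrite mxE; have := chi_le i; have := r_gt0 i; nia.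
- by rewrite mxE le_max lexx.
- by exists k; rewrite mxE; lia.
exists j; split.
  (* A positive entry of the positive part means that [chi 0 j] exceeds [r 0 j], itself positive. *)
  by move: chi'j; rewrite mxE; have := r_gt0 j; lia.
by rewrite f_ge0 (lt_le_trans f_lt) // pairing_pos_part_sub.
Qed.

Lemma parking_functions_subset {n : nat} (Delta : 'M[int]_n)
    (offdiag_le0 : forall i j : 'I_n, i <> j -> Delta i j <= 0)
    (r r' : 'rV[int]_n) :
  Rset Delta r ->
  (parking_functions Delta r `<=` parking_functions Delta r')%classic.
Proof.
move=> hr f parkf chi [chi_bounds chi_neq0].
(* Vectors of [Omega r'] are nonnegative and nonzero, so the condition extended from [r] covers
   them. *)
by apply: is_parking_all hr parkf _ chi_neq0 => // i; case/andP: (chi_bounds i).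
Qed.

Theorem theorem2p8 (n : nat) (Delta : 'M[int]_n)
    (n_ge1 : (1 <= n)%N)
    (det_neq0 : \det Delta <> 0)
    (offdiag_le0 : forall i j : 'I_n, i <> j -> Delta i j <= 0)
    (ex_pos : exists r : 'rV[int]_n, pos_vec r /\ ge_vec (r *m Delta) 0)
    (r r' : 'rV[int]_n) (hr : Rset Delta r) (hr' : Rset Delta r') :
  parking_functions Delta r = parking_functions Delta r'.
Proof.
by apply/seteqP; split; apply: parking_functions_subset.
Qed.
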